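(* Let $A$ be a closed linear operator in a real or complex reflexive Banach space $(X,\|\cdot\|)$, with domain $D(A)$, kernel $\ker A$ and range $R(A)$. (i) If $A$ has an inverse $A^{-1}$ (i.e. $\ker A=\{0\}$; the inverse need not be bounded or everywhere defined), then, for each bounded weak solution $y(\cdot)$ of the equation $y'(t)=Ay(t)$, $t\ge 0$, the means $\frac{1}{t}\int_0^t y(s)\,ds$ converge weakly in $X$ to $0$ as $t\to\infty$. (ii) If the direct sum decomposition $$X=\ker A\oplus\overline{R(A)}$$ holds, then, for each bounded weak solution $y(\cdot)$ of the equation $y'(t)=Ay(t)$, $t\ge 0$, the means $\frac{1}{t}\int_0^t y(s)\,ds$ converge weakly in $X$ to $Py(0)$ as $t\to\infty$, where $P$ is the projection onto $\ker A$ along $\overline{R(A)}$.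
   Context: The operator $A$ is a closed linear operator $A:D(A)\subseteq X\to X$, not necessarily bounded or densely defined; $\overline{R(A)}$ is the norm closure of its range. A weak solution of $y'(t)=Ay(t)$, $t\ge0$, is a norm-continuous function $y:[0,\infty)\to X$ such that, for all $t\ge 0$, $\int_0^t y(s)\,ds\in D(A)$ and $y(t)=y(0)+A\int_0^t y(s)\,ds$. It is bounded if $\sup_{t\ge0}\|y(t)\|<\infty$. *)

(* Defs.v *)
From mathcomp Require Import all_boot all_order all_algebra.
From mathcomp Require Import complex.
From mathcomp Require Import all_classical all_reals all_analysis.

Set Implicit Arguments.
Unset Strict Implicit.
Unset Printing Implicit Defensive.

Import Order.TTheory GRing.Theory Num.Theory.
Import numFieldNormedType.Exports.

Local Open Scope classical_set_scope.
Local Open Scope ring_scope.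

(* The scalar field K is either R or R[i], and ofR is the inclusion of R in K.
   Norms on a normedModType K take their values in K, so real quantities are
   compared with them through ofR. *)
Inductive real_or_complex (R : realType) :
    forall K : numFieldType, (R -> K) -> Prop :=
| RealScalars : @real_or_complex R R id
| ComplexScalars : @real_or_complex R R[i] (real_complex R).

Section Reflexivity.
Context {R : realType} {K : numFieldType} (ofR : R -> K).
Context (X : normedModType K).

(* The dual and the bidual are sets of functions; only the values of phi on
   dual_space matter for membership in bidual_space and in reflexive_space. *)
Definition dual_space : set (X -> K^o) := [set f | linear f /\ continuous f].

Definition dual_norm (f : X -> K^o) : R :=
  inf [set C : R | 0 <= C /\ forall x, `|f x| <= ofR C * `|x|].

Definition bidual_space : set ((X -> K^o) -> K^o) :=
  [set phi |
    (forall (a : K) f g, dual_space f -> dual_space g ->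
       phi (a *: f + g) = a *: phi f + phi g) /\
    exists M : R, forall f, dual_space f -> `|phi f| <= ofR (M * dual_norm f)].

(* The canonical embedding x |-> (f |-> f x) of X in its bidual is onto. *)
Definition reflexive_space : Prop :=
  forall phi, bidual_space phi ->
    exists x : X, forall f, dual_space f -> phi f = f x.

Definition weak_cvg {T : Type} (m : T -> X) (F : set_system T) (x : X) : Prop :=
  forall f, dual_space f -> f (m t) @[t --> F] --> f x.

End Reflexivity.

Section RiemannIntegral.
Context {R : realType} {K : numFieldType} (ofR : R -> K).
Context {X : normedModType K}.

(* For s = [:: x_1; ...; x_n] with a < x_1 < ... < x_n = b, the i-th interval
   is [x_i, x_(i+1)], where x_0 = a, and xi i is its tag. *)
Definition tagged_partition (a b : R) (s : seq R) (xi : nat -> R) : Prop :=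
  itv_partition a b s /\
  forall i, (i < size s)%N -> nth b (a :: s) i <= xi i <= nth b s i.

Definition mesh_lt (a b : R) (s : seq R) (d : R) : Prop :=
  forall i, (i < size s)%N -> nth b s i - nth b (a :: s) i < d.

Definition riemann_sum (y : R -> X) (a b : R) (s : seq R) (xi : nat -> R) : X :=
  \sum_(i < size s) ofR (nth b s i - nth b (a :: s) i) *: y (xi i).

Definition is_riemann_integral (y : R -> X) (a b : R) (I : X) : Prop :=
  forall e : R, 0 < e -> exists2 d : R, 0 < d &
    forall s xi, tagged_partition a b s xi -> mesh_lt a b s d ->
      `|riemann_sum y a b s xi - I| < ofR e.

(* For a <= b, the integral of y over [a, b] if y is Riemann integrable there
   (in particular if y is continuous and X is complete), and 0 otherwise. *)
Definition riemann_integral (y : R -> X) (a b : R) : X :=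
  xget 0 [set I | is_riemann_integral y a b I].

End RiemannIntegral.

(* A linear operator in X with domain dom; the values of oper outside dom are
   irrelevant and all the notions below ignore them. *)
Record linear_operator (K : numFieldType) (X : normedModType K) := LinearOperator {
  dom : set X;
  oper :> X -> X;
  dom0 : dom 0;
  dom_linear : forall (a : K) u v, dom u -> dom v -> dom (a *: u + v);
  oper_linear : forall (a : K) u v, dom u -> dom v ->
    oper (a *: u + v) = a *: oper u + oper v
}.

Section Operators.
Context {R : realType} {K : numFieldType} (ofR : R -> K).
Context {X : normedModType K}.
Implicit Types (A : linear_operator X) (M N : set X) (y : R -> X).

Definition graph A : set (X * X) := [set p | dom A p.1 /\ p.2 = A p.1].

Definition closed_operator A : Prop := closed (graph A).

Definition ker A : set X := [set x | dom A x /\ A x = 0].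

Definition ran A : set X := A @` dom A.

Definition direct_sum M N : Prop :=
  M `&` N = [set 0] /\ forall x, exists u v, [/\ M u, N v & x = u + v].

(* The projection onto M along N, when the space is the direct sum of M and N. *)
Definition projection_along M N (x : X) : X :=
  xget 0 [set u | M u /\ N (x - u)].

(* Functions on [0, +oo[ are represented by functions on R, of which only the
   values on [0, +oo[ are used. *)
Definition weak_solution A y : Prop :=
  {within `[0, +oo[, continuous y} /\
  forall t : R, 0 <= t ->
    dom A (riemann_integral ofR y 0 t) /\
    y t = y 0 + A (riemann_integral ofR y 0 t).

Definition bounded_on_halfline y : Prop := [bounded y t | t in `[0, +oo[].

Definition mean y (t : R) : X := ofR t^-1 *: riemann_integral ofR y 0 t.

End Operators.

(* Main.v *)
From HB Require Import structures.
Require Import Defs.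
From mathcomp Require Import all_boot all_order all_algebra.
From mathcomp Require Import complex.
From mathcomp Require Import all_classical all_reals all_analysis.
From mathcomp Require Import ring lra.
Import Order.TTheory GRing.Theory Num.Theory.
Import numFieldNormedType.Exports.
Local Open Scope classical_set_scope.
Local Open Scope ring_scope.
Set Implicit Arguments.
Unset Strict Implicit.
Unset Printing Implicit Defensive.

(** The mean [m t = t^-1 * int_0^t y] is bounded, because [y] is, and applying
[A] to it gives [A (m t) = t^-1 * (y t - y 0)], which tends to [0] in norm as
[t] grows. In a reflexive space a bounded family converges weakly along every
ultrafilter: the functional [f |-> lim f (m t)] is a bounded functional on the
dual, hence it is evaluation at a point [x] (reflexive_ultra_weak_cvg). So the
pair [(m t, A (m t))] of the graph of [A] converges weakly to [(x, 0)]. A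
closed subspace of a normed space is weakly closed, by the Hahn-Banach
separation of a point from a subspace (closure_separation); applied to the
graph in [X * X] this puts [(x, 0)] in the graph, that is [x] in [ker A]
(weak_limit_ker).

If [ker A] is trivial, every such limit is [0]. In general, a continuous linear
functional [f] that vanishes on [ran A] satisfies [f (y s) = f (y 0)] for all
[s], since [y s - y 0] lies in [ran A]; averaging gives [f (m t) = f (y 0)]
(dual_mean), so that [f (y 0 - x) = 0]. By separation [y 0 - x] lies in the
closure of [ran A], and [x] is the component of [y 0] in [ker A]. In both cases
the limit does not depend on the ultrafilter, which gives convergence as [t]
tends to infinity (cvg_ultraP).

The two tools proved on the way are the Hahn-Banach theorem over real or complex
scalars and the convergence of the Riemann sums of a continuous function with
values in a Banach space. *)

(** * Real and complex scalars *)

Section Scalars.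
Context {R : realType} {K : numFieldType} {ofR : R -> K}.
Hypothesis roc : real_or_complex ofR.

Lemma ofRD a b : ofR (a + b) = ofR a + ofR b.
Proof. by case: roc => //; exact: rmorphD. Qed.

Lemma ofRM a b : ofR (a * b) = ofR a * ofR b.
Proof. by case: roc => //; exact: rmorphM. Qed.

Lemma ofR1 : ofR 1 = 1.
Proof. by case: roc. Qed.

Lemma ofR0 : ofR 0 = 0.
Proof. by case: roc. Qed.

Lemma ofRN a : ofR (- a) = - ofR a.
Proof. by case: roc => //; exact: rmorphN. Qed.

Lemma ofRV a : ofR a^-1 = (ofR a)^-1.
Proof. by case: roc => //; exact: fmorphV. Qed.

Lemma ofR_le a b : (ofR a <= ofR b) = (a <= b).
Proof. by case: roc => //; exact: lecR. Qed.

Lemma ofR_lt a b : (ofR a < ofR b) = (a < b).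
Proof. by case: roc => //; exact: ltcR. Qed.

Lemma ofR_ge0 a : (0 <= ofR a) = (0 <= a).
Proof. by rewrite -ofR0 ofR_le. Qed.

Lemma ofR_gt0 a : (0 < ofR a) = (0 < a).
Proof. by rewrite -ofR0 ofR_lt. Qed.

Lemma normr_ofR a : `|ofR a| = ofR `|a|.
Proof.
have [a0|a0] := leP 0 a; first by rewrite !ger0_norm// ofR_ge0.
by rewrite !ler0_norm ?ltW// -1?ofR0 ?ofR_lt// -ofRN.
Qed.

(** Norms take their values in [K]; this is what turns them into real numbers. *)
Lemma ge0_ofR (k : K) : 0 <= k -> exists r, k = ofR r.
Proof.
case: roc k => [k _|k k0]; first by exists k.
by exists (complex.Re k); rewrite RRe_real// ger0_real.
Qed.

End Scalars.

Lemma normc_real (R : realType) (a : R) : `|(a%:C)%C| = (`|a|%:C)%C.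
Proof. exact: (normr_ofR (ComplexScalars R)). Qed.

Lemma norm_i (R : realType) : `|'i%C| = 1 :> R[i].
Proof. by rewrite normc_def /= expr0n/= add0r expr1n sqrtr1. Qed.

(** An ultrafilter contains the preimage of a set or of its complement, so that no
filter can strictly refine its image. *)
Lemma ultra_fmap (T S : Type) (f : T -> S) (U : set_system T) :
  UltraFilter U -> UltraFilter (f t @[t --> U]).
Proof.
move=> UU; split; first exact: fmap_proper_filter.
move=> G GP UG; apply/seteqP; split=> // A GA.
have [//|UA] := in_ultra_setVsetC (f @^-1` A) UU.
have GAC : G (~` A) by exact: UG.
have := filterI GA GAC; rewrite setICr => G0.
by have [] := @filter_not_empty _ G _ (G0 _).
Qed.

Lemma ultra_cvg_real (R : realType) (T : Type) (U : set_system T)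
    (UU : UltraFilter U) (h : T -> R) (C : R) :
  (\forall t \near U, `|h t| <= C) -> cvg (h t @[t --> U]).
Proof.
move=> hC.
have UP : ProperFilter U by exact: ultra_proper.
have := segment_compact (a := - C) (b := C).
rewrite compact_ultra => /(_ (h t @[t --> U]))[].
- exact: ultra_fmap.
- by near=> t; rewrite /= in_itv /= -ler_norml; near: t.
- by move=> l [_ hl]; apply/cvg_ex; exists l.
Unshelve. all: by end_near. Qed.

(** Bounded closed intervals are compact; over the complex numbers this is used
for the real and the imaginary part separately. *)
Lemma ultra_cvg_bounded {R : realType} {K : numFieldType} {ofR : R -> K}
    (roc : real_or_complex ofR) (T : Type) (U : set_system T)
    (UU : UltraFilter U) (h : T -> K) (C : R) :
  (\forall t \near U, `|h t| <= ofR C) -> cvg (h t @[t --> U]).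
Proof.
have UP : ProperFilter U by exact: ultra_proper.
case: roc h => [h|h hC]; first exact: ultra_cvg_real.
have cRe : cvg (complex.Re (h t) @[t --> U]).
  apply: (@ultra_cvg_real _ _ _ _ _ C).
  near=> t; rewrite -lecR; apply: le_trans (normc_ge_Re _) _; near: t; exact: hC.
have cIm : cvg (complex.Im (h t) @[t --> U]).
  apply: (@ultra_cvg_real _ _ _ _ _ C).
  near=> t; rewrite -lecR; apply: le_trans (_ : `|h t| <= _); last first.
    by near: t; exact: hC.
  have := normc_ge_Re (h t * 'i%C).
  rewrite ReiNIm normrN normrM => /le_trans; apply.
  by rewrite norm_i mulr1.
apply/cvg_ex; exists (lim (complex.Re (h t) @[t --> U]) +i* lim (complex.Im (h t) @[t --> U]))%C.
apply/cvgrPdist_lt => e e0.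
have [r er] : exists r, e = (r%:C)%C.
  by exists (complex.Re e); rewrite RRe_real// gtr0_real.
have r0 : 0 < r by rewrite er -[0]/((0:R)%:C)%C ltcR in e0.
have r20 : 0 < r / 2 by rewrite divr_gt0.
have /cvgrPdist_lt /(_ _ r20) hRe := cRe.
have /cvgrPdist_lt /(_ _ r20) hIm := cIm.
near=> t.
set a := lim _; set b := lim _.
rewrite [X in `|X|](_ : _ = ((a - complex.Re (h t))%:C + 'i%C * (b - complex.Im (h t))%:C)%C); last first.
  by rewrite [h t]complexE /=; simpc.
apply: le_lt_trans (ler_normD _ _) _.
rewrite normrM norm_i mul1r !normc_real er -rmorphD ltcR [ltRHS]splitr ltrD//.
  by near: t.
by near: t.
Unshelve. all: by end_near. Qed.

(** Over the complex numbers a real-linear functional [g] is the real part of the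
complex-linear functional [v |-> g v - i * g (i * v)]. Since [q] does not change
under multiplication by [i], both terms are bounded by [q v], hence the factor
[2]. A bound by [q], rather than by the norm, makes the functional vanish
wherever [q] does. *)
Lemma scalar_functional {R : realType} {K : numFieldType} {ofR : R -> K}
    (roc : real_or_complex ofR) (V : lmodType K) (q g : V -> R) :
  (forall c v, `|c| = 1 -> q (c *: v) = q v) ->
  (forall a u v, g (ofR a *: u + v) = a * g u + g v) ->
  (forall v, `|g v| <= q v) ->
  exists F : V -> K^o, [/\ linear F, forall v, `|F v| <= ofR (2 * q v) &
    forall v, g v != 0 -> F v != 0].
Proof.
case: roc V q g => [V q g _ gl gq|V q g qi gl gq].
  exists g; split=> // v.
  by have := gq v; have := normr_ge0 (g v); lra.
have gD u v : g (u + v) = g u + g v.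
  by have := gl 1 u v; rewrite rmorph1 scale1r mul1r.
have g0 : g 0 = 0 by have := gD 0 0; rewrite addr0; lra.
have gZ a u : g ((a%:C)%C *: u) = a * g u.
  by have := gl a u 0; rewrite !addr0 g0 addr0.
have gE x y u : g ((x +i* y)%C *: u) = x * g u + y * g ('i%C *: u).
  rewrite -!gZ -gD scalerA -scalerDl; congr (g (_ *: _)).
  by simpc.
exists (fun v => (g v +i* (- g ('i%C *: v)))%C); split.
- move=> [x y] u v /=; rewrite scalerDr scalerA !gD gE.
  have -> : ('i * (x +i* y))%C = (- y +i* x)%C by simpc.
  rewrite (gE (- y) x); set r := g u; set i := g ('i%C *: u).
  rewrite [RHS](_ : _ = ((x +i* y) * (r -i* i) + (g v -i* g ('i%C *: v)))%C) //.
  by simpc; congr (_ +i* _)%C; ring.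
- move=> v.
  rewrite [X in `|X|](_ : _ = ((g v)%:C + 'i%C * (- g ('i%C *: v))%:C)%C); last first.
    by simpc.
  apply: le_trans (ler_normD _ _) _.
  rewrite normrM norm_i mul1r !normc_real -rmorphD lecR normrN.
  by have := gq v; have := gq ('i%C *: v); rewrite qi ?norm_i//; lra.
- by move=> v; apply: contraNneq => /eqP; rewrite eq_complex /= => /andP[].
Qed.

(** * The Hahn-Banach theorem by minimal sublinear functionals *)

Section HahnBanach.
Context {R : realType} {K : numFieldType} {ofR : R -> K}.
Hypothesis roc : real_or_complex ofR.

Section Sublinear.
Context {V : lmodType K}.
Implicit Types (p q : V -> R) (u v w : V).

(** Only real scalars enter, through [ofR], so that the same notion serves real and
complex spaces. *)
Definition sublinear p :=
  (forall u v, p (u + v) <= p u + p v) /\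
  (forall a u, 0 <= a -> p (ofR a *: u) <= a * p u).

Lemma sublinear0 p : sublinear p -> p 0 = 0.
Proof.
move=> [pD pZ]; have := pD 0 0; rewrite addr0.
by have := pZ 0 0 (lexx _); rewrite scaler0; lra.
Qed.

Lemma sublinearN p v : sublinear p -> - p (- v) <= p v.
Proof.
move=> sp; have := sp.1 v (- v); rewrite subrr (sublinear0 sp); lra.
Qed.

Lemma sublinearZ p a u : sublinear p -> 0 <= a -> p (ofR a *: u) = a * p u.
Proof.
move=> sp; rewrite le_eqVlt => /predU1P[<-|a0].
  by rewrite (ofR0 roc) scale0r mul0r sublinear0.
apply/eqP; rewrite eq_le (sp.2 _ _ (ltW a0))/=.
have := sp.2 a^-1 (ofR a *: u); rewrite scalerA -(ofRM roc) mulVf ?gt_eqF//.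
rewrite (ofR1 roc) scale1r invr_ge0 => /(_ (ltW a0)).
by rewrite ler_pdivlMl.
Qed.

(** For sublinear [p], the largest sublinear functional below [p] whose value at
[- u] is at most [- p u]. A sublinear functional that equals all its lowered
versions is additive. *)
Definition lowered p u v : R :=
  inf [set p (v + ofR r *: u) - r * p u | r in [set r | 0 <= r]].

Lemma lowered_le p u v r : sublinear p -> 0 <= r ->
  lowered p u v <= p (v + ofR r *: u) - r * p u.
Proof.
move=> sp r0; apply: ge_inf; last by exists r.
exists (- p (- v)) => _ [s /= s0 <-].
have := sp.1 (- v) (v + ofR s *: u); rewrite addKr sublinearZ//; lra.
Qed.

Lemma lowered_ge p u v l : 
  (forall r, 0 <= r -> l <= p (v + ofR r *: u) - r * p u) -> l <= lowered p u v.
Proof.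
move=> h; apply: lb_le_inf; first by exists (p (v + ofR 0 *: u) - 0 * p u), 0 => /=.
by move=> _ [r /= r0 <-]; exact: h.
Qed.

Lemma lowered_le_id p u v : sublinear p -> lowered p u v <= p v.
Proof.
move=> sp; have := lowered_le u v sp (lexx 0).
by rewrite (ofR0 roc) scale0r addr0 mul0r subr0.
Qed.

Lemma lowered_sublinear p u : sublinear p -> sublinear (lowered p u).
Proof.
move=> sp; split=> [v w|a v].
  have h r s : 0 <= r -> 0 <= s -> lowered p u (v + w) <=
      (p (v + ofR r *: u) - r * p u) + (p (w + ofR s *: u) - s * p u).
    move=> r0 s0; apply: le_trans (lowered_le u _ sp (addr_ge0 r0 s0)) _.
    have := sp.1 (v + ofR r *: u) (w + ofR s *: u).
    by rewrite addrACA -scalerDl -(ofRD roc); lra.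
  rewrite -lerBlDr; apply: lowered_ge => r r0; rewrite lerBlDr -lerBlDl.
  by apply: lowered_ge => s s0; rewrite lerBlDl; exact: h.
rewrite le_eqVlt => /predU1P[<-|a0].
  rewrite (ofR0 roc) scale0r mul0r; apply: le_trans (lowered_le_id _ _ sp) _.
  by rewrite sublinear0.
rewrite -ler_pdivrMl//; apply: lowered_ge => r r0.
rewrite ler_pdivrMl//; apply: le_trans (lowered_le u _ sp (mulr_ge0 (ltW a0) r0)) _.
rewrite (ofRM roc) -scalerA -scalerDr (sublinearZ _ sp (ltW a0)).
by rewrite mulrBr mulrA.
Qed.

(** The values at [v] of the sublinear functionals below [q] are bounded below by
[- q (- v)], so that the pointwise infimum of a chain is finite; it is
subadditive because two members of a chain can be replaced with the smaller
one. *)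
Lemma chain_inf_sublinear q (C : set (V -> R)) :
  C !=set0 -> (forall p, C p -> sublinear p) ->
  (forall p, C p -> forall v, p v <= q v) ->
  (forall p p', C p -> C p' -> (forall v, p v <= p' v) \/ (forall v, p' v <= p v)) ->
  exists p, [/\ sublinear p, forall v, p v <= q v &
    forall p', C p' -> forall v, p v <= p' v].
Proof.
move=> [p0 Cp0] Cs Cq Ct.
pose m v := inf [set p v | p in C].
have m_le p v : C p -> m v <= p v.
  move=> Cp; apply: ge_inf; last by exists p.
  exists (- q (- v)) => _ [p' Cp' <-].
  by have := sublinearN v (Cs _ Cp'); have := Cq _ Cp' (- v); lra.
have m_ge v l : (forall p, C p -> l <= p v) -> l <= m v.
  move=> h; apply: lb_le_inf; first by exists (p0 v), p0.
  by move=> _ [p Cp <-]; exact: h.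
exists m; split=> [|v|p' Cp' v]; last 2 first.
- exact: le_trans (m_le _ _ Cp0) (Cq _ Cp0 v).
- exact: m_le.
split=> [u v|a v].
  rewrite -lerBlDr; apply: (m_ge _ _ _) => p Cp; rewrite lerBlDr -lerBlDl.
  apply: (m_ge _ _ _) => p' Cp'; rewrite lerBlDl.
  have [pp'|p'p] := Ct _ _ Cp Cp'.
    have := m_le _ (u + v) Cp; have := (Cs _ Cp).1 u v; have := pp' v; lra.
  have := m_le _ (u + v) Cp'; have := (Cs _ Cp').1 u v; have := p'p u; lra.
rewrite le_eqVlt => /predU1P[<-|a0].
  have := m_le _ (ofR 0 *: v) Cp0.
  by rewrite (ofR0 roc) scale0r mul0r (sublinear0 (Cs _ Cp0)).
rewrite -ler_pdivrMl//; apply: (m_ge _ _ _) => p Cp; rewrite ler_pdivrMl//.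
exact: le_trans (m_le _ _ Cp) ((Cs _ Cp).2 _ _ (ltW a0)).
Qed.

Lemma minimal_sublinear q : sublinear q ->
  exists p, [/\ sublinear p, forall v, p v <= q v &
    forall p', sublinear p' -> (forall v, p' v <= p v) -> p' = p].
Proof.
move=> sq.
pose T := {p : V -> R | sublinear p /\ forall v, p v <= q v}.
pose le (s t : T) := `[< forall v, sval t v <= sval s v >].
have [| | |C Ct|[p [sp pq]] pmax] := @Zorn T le.
- by move=> t; apply/asboolP.
- move=> r s t /asboolP rs /asboolP st; apply/asboolP => v.
  exact: le_trans (st v) (rs v).
- move=> [p hp] [p' hp'] /asboolP /= pp' /asboolP /= p'p.
  apply: eq_exist; apply/funext => v; apply/eqP.
  by rewrite eq_le p'p pp'.
- have [->|/set0P[t0 Ct0]] := eqVneq C set0.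
    by exists (exist _ q (conj sq (fun v => lexx _))) => s.
  have [|p [t Ct1 <-]|p [t Ct1 <-]|p p' [t Ct1 <-] [t' Ct2 <-]|m [sm mq mC]] :=
      @chain_inf_sublinear q [set sval t | t in C].
  + by exists (sval t0), t0.
  + by case: (svalP t).
  + by case: (svalP t).
  + by have [/asboolP|/asboolP] := Ct _ _ Ct1 Ct2; [right|left].
  + exists (exist _ m (conj sm mq)) => s Cs; apply/asboolP => v /=.
    by apply: mC; exists s.
- exists p; split=> // p' sp' p'p.
  have p'q v : p' v <= q v by exact: le_trans (p'p v) (pq v).
  have le_p' : le (exist _ p (conj sp pq)) (exist _ p' (conj sp' p'q)).
    exact/asboolP.
  by case: (pmax _ le_p').
Qed.

(** Minimality gives [lowered p v = p], whence [p u <= p (u + v) - p v]. *)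
Lemma minimal_sublinear_linear p : sublinear p ->
  (forall p', sublinear p' -> (forall v, p' v <= p v) -> p' = p) ->
  forall a u v, p (ofR a *: u + v) = a * p u + p v.
Proof.
move=> sp pmin.
have pD u v : p (u + v) = p u + p v.
  apply/eqP; rewrite eq_le sp.1 /=.
  have <- := congr1 (fun f => f u) (pmin _ (lowered_sublinear v sp) (fun w => lowered_le_id v w sp)).
  have := lowered_le v u sp ler01; rewrite (ofR1 roc) scale1r mul1r.
  by rewrite -lerBrDr.
have pN u : p (- u) = - p u.
  by have := pD u (- u); rewrite subrr (sublinear0 sp); lra.
move=> a u v; rewrite pD; congr (_ + _).
have [a0|a0] := leP 0 a; first exact: sublinearZ.
rewrite -[a]opprK (ofRN roc) scaleNr pN sublinearZ ?mulNr// oppr_ge0.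
exact: ltW.
Qed.

(** A linear functional below [lowered q x] is at most [- q x] at [- x], hence at
least [q x] at [x]. *)
Lemma sublinear_functional q x : sublinear q ->
  exists g : V -> R, [/\ forall a u v, g (ofR a *: u + v) = a * g u + g v,
    forall v, g v <= q v & g x = q x].
Proof.
move=> sq; have sd := lowered_sublinear x sq.
have [p [sp pd pmin]] := minimal_sublinear sd.
have pq v : p v <= q v by exact: le_trans (pd v) (lowered_le_id x v sq).
exists p; split=> //; first exact: minimal_sublinear_linear.
apply/eqP; rewrite eq_le pq /=.
have := sublinearN x sp; have := pd (- x); have := lowered_le x (- x) sq ler01.
rewrite (ofR1 roc) scale1r addNr mul1r (sublinear0 sq); lra.
Qed.

End Sublinear.

(** * Separation of a point from a closed subspace *)

Section Normed.
Context {X : normedModType K}.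
Implicit Types (x u v : X) (M : set X).

(** The norm as a real number, whereas [`|x|] lies in the scalar field. *)
Definition rnorm x : R := xget 0 [set r | `|x| = ofR r].

Lemma rnormE x : ofR (rnorm x) = `|x|.
Proof.
have [r xr] := ge0_ofR roc (normr_ge0 x).
by rewrite /rnorm; case: xgetP => [s _ ->//|/(_ r)].
Qed.

Lemma rnorm_ge0 x : 0 <= rnorm x.
Proof. by rewrite -(ofR_ge0 roc) rnormE. Qed.

Definition subspace M := M 0 /\ forall (a : K) u v, M u -> M v -> M (a *: u + v).

Definition dist_to M v : R := inf [set rnorm (v - m) | m in M].

Section Distance.
Context (M : set X).
Hypothesis sM : subspace M.

Lemma dist_to_le v m : M m -> dist_to M v <= rnorm (v - m).
Proof.
move=> Mm; apply: ge_inf; last by exists m.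
by exists 0 => _ [u _ <-]; exact: rnorm_ge0.
Qed.

Lemma dist_to_ge v l : (forall m, M m -> l <= rnorm (v - m)) -> l <= dist_to M v.
Proof.
move=> h; apply: lb_le_inf; first by exists (rnorm (v - 0)), 0; [exact: sM.1|].
by move=> _ [m Mm <-]; exact: h.
Qed.

Lemma dist_to_le_norm v : dist_to M v <= rnorm v.
Proof. by have := dist_to_le v sM.1; rewrite subr0. Qed.

Lemma dist_to_eq0 v : M v -> dist_to M v = 0.
Proof.
move=> Mv; apply/eqP; rewrite eq_le; apply/andP; split; last first.
  by apply: dist_to_ge => m _; exact: rnorm_ge0.
apply: le_trans (dist_to_le v Mv) _.
by rewrite -(ofR_le roc) rnormE (ofR0 roc) subrr normr0.
Qed.

Lemma dist_to_scale_le (c : K) a v : `|c| = ofR a -> dist_to M (c *: v) <= a * dist_to M v.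
Proof.
move=> ca; have a0 : 0 <= a by rewrite -(ofR_ge0 roc) -ca.
have h m : M m -> dist_to M (c *: v) <= a * rnorm (v - m).
  move=> Mm; have Mcm : M (c *: m) by have := sM.2 c _ _ Mm sM.1; rewrite addr0.
  apply: le_trans (dist_to_le _ Mcm) _.
  by rewrite -(ofR_le roc) (ofRM roc) !rnormE -scalerBr normrZ ca.
move: a0; rewrite le_eqVlt => /predU1P[a0|a0].
  by have := h _ sM.1; rewrite -a0 !mul0r.
rewrite -ler_pdivrMl//; apply: dist_to_ge => m Mm; rewrite ler_pdivrMl//.
exact: h.
Qed.

Lemma dist_to_sublinear : sublinear (dist_to M).
Proof.
split=> [u v|a v a0]; last first.
  by apply: dist_to_scale_le; rewrite (normr_ofR roc) ger0_norm.
have h m m' : M m -> M m' -> dist_to M (u + v) <= rnorm (u - m) + rnorm (v - m').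
  move=> Mm Mm'; have Mmm : M (m + m') by have := sM.2 1 _ _ Mm Mm'; rewrite scale1r.
  apply: le_trans (dist_to_le _ Mmm) _.
  by rewrite -(ofR_le roc) (ofRD roc) !rnormE opprD addrACA ler_normD.
rewrite -lerBlDr; apply: dist_to_ge => m Mm; rewrite lerBlDr -lerBlDl.
by apply: dist_to_ge => m' Mm'; rewrite lerBlDl; exact: h.
Qed.

(** This invariance is what [scalar_functional] requires of the dominating
functional. *)
Lemma dist_to_unit (c : K) v : `|c| = 1 -> dist_to M (c *: v) = dist_to M v.
Proof.
move=> c1; apply/eqP; rewrite eq_le; apply/andP; split.
  by have := @dist_to_scale_le c 1 v; rewrite (ofR1 roc) mul1r; exact.
have c0 : c != 0 by rewrite -normr_eq0 c1 oner_eq0.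
have := @dist_to_scale_le c^-1 1 (c *: v).
by rewrite (ofR1 roc) mul1r scalerA mulVf// scale1r; apply; rewrite normfV c1 invr1.
Qed.

Lemma dist_to_closure v : dist_to M v <= 0 -> closure M v.
Proof.
move=> d0 B /nbhs_ballP[e /= e0 eB].
have [r er] := ge0_ofR roc (ltW e0).
have r0 : 0 < r by rewrite -(ofR_gt0 roc) -er.
apply: contrapT => nMB.
suff : r <= dist_to M v by lra.
apply: dist_to_ge => m Mm; rewrite leNgt; apply/negP => mr; apply: nMB.
exists m; split=> //; apply: eB; rewrite -ball_normE /ball_/=.
by rewrite er -rnormE (ofR_lt roc).
Qed.

End Distance.

Lemma norm_limit_le {T : Type} (F : set_system T) (FF : ProperFilter F)
    (h : T -> X) x (C : R) :
  h @ F --> x -> (\forall t \near F, `|h t| <= ofR C) -> `|x| <= ofR C.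
Proof.
move=> /cvgrPdist_lt hx hC; rewrite -rnormE (ofR_le roc) leNgt; apply/negP => Cx.
have e0 : 0 < ofR (rnorm x - C) by rewrite (ofR_gt0 roc) subr_gt0.
have [t [xt tC]] := filter_ex (filterI (hx _ e0) hC).
suff : `|x| < `|x| by rewrite ltxx.
have /le_lt_trans : `|x| <= `|x - h t| + `|h t| by rewrite -{1}(subrK (h t) x) ler_normD.
apply; apply: lt_le_trans (ltr_leD xt tC) _.
by rewrite -(ofRD roc) subrK rnormE.
Qed.

(** Gives access to the lemmas on [{linear X -> K^o}] for the elements of
[dual_space], which are bare functions. *)
Lemma linear_bundle (f : X -> K^o) : linear f ->
  exists g : {linear X -> K^o}, f = g.
Proof.
move=> lf; pose m := GRing.isLinear.Build K X K^o *:%R f lf.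
by exists (HB.pack f m : {linear X -> K^o}).
Qed.

Lemma bounded_dual (f : X -> K^o) C : linear f -> 0 <= C ->
  (forall x, `|f x| <= ofR C * `|x|) -> dual_space f.
Proof.
move=> lf C0 fC; split=> //; have [g fg] := linear_bundle lf.
rewrite fg in fC *; apply: bounded_linear_continuous.
apply/ex_bound; exists (ofR C); near=> x; apply: le_trans (fC x) _.
by rewrite ler_piMr ?(ofR_ge0 roc)// ltW//; near: x; exact: nbhs0_lt.
Unshelve. all: by end_near. Qed.

Lemma dual_bounded (f : X -> K^o) : dual_space f ->
  exists2 C, 0 <= C & forall x, `|f x| <= ofR C * `|x|.
Proof.
move=> [lf cf]; have [g fg] := linear_bundle lf; rewrite fg in cf *.
have /linear_boundedP /pinfty_ex_gt0[r r0 rg] := continuous_linear_bounded 0 (cf 0).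
have [C rC] := ge0_ofR roc (ltW r0).
exists C; first by rewrite -(ofR_ge0 roc) -rC ltW.
by move=> x; rewrite -rC.
Qed.

Lemma dual_closure_eq0 M (f : X -> K^o) x : dual_space f ->
  (forall m, M m -> f m = 0) -> closure M x -> f x = 0.
Proof.
move=> df fM; have cl : closed (f @^-1` [set 0]).
  apply: closed_comp => [u _|]; first exact: df.2.
  exact/accessible_closed_set1/hausdorff_accessible/norm_hausdorff.
by rewrite closureE => /(_ _ (conj cl fM)).
Qed.

(** If [x] were not in the closure of [M], its distance to [M] would be positive.
A functional dominated by the distance to [M] and equal to it at [x] would then
vanish on [M] and not at [x]. *)
Theorem closure_separation M x : subspace M ->
  (forall f, dual_space f -> (forall m, M m -> f m = 0) -> f x = 0) -> closure M x.
Proof.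
move=> sM h.
apply: (dist_to_closure sM); rewrite leNgt; apply/negP => d0.
have [g [gl gd gx]] := sublinear_functional x (dist_to_sublinear sM).
have g0 : g 0 = 0 by have := gl 1 0 0; rewrite scaler0 addr0; lra.
have gabs v : `|g v| <= dist_to M v.
  rewrite ler_norml gd andbT.
  have := gd (-1 *: v); rewrite dist_to_unit ?normrN1//.
  have := gl (-1) v 0; rewrite (ofRN roc) (ofR1 roc) !addr0 g0 => ->; lra.
have [F [lF Fd Fn]] := scalar_functional roc (dist_to_unit sM) gl gabs.
have dF : dual_space F.
  apply: (@bounded_dual _ 2) => // v; rewrite -rnormE -(ofRM roc).
  apply: le_trans (Fd v) _; rewrite (ofR_le roc) ler_pM2l//.
  exact: dist_to_le_norm.
have /eqP : F x = 0.
  apply: h => // m Mm; apply/eqP; rewrite -normr_eq0 eq_le normr_ge0 andbT.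
  by have := Fd m; rewrite dist_to_eq0// mulr0 (ofR0 roc).
by apply/negP/Fn; rewrite gx gt_eqF.
Qed.

End Normed.
End HahnBanach.

Arguments rnorm {R K} ofR {X} x.

(** * Riemann integrals of continuous functions *)

Section RiemannSums.
Context {R : realType} {K : numFieldType} {ofR : R -> K}.
Hypothesis roc : real_or_complex ofR.
Implicit Types (a b d t u x : R) (s : seq R) (xi : nat -> R).

Lemma tagged_partition_cons a b x s xi : tagged_partition a b (x :: s) xi ->
  [/\ a < x, a <= xi 0%N <= x & tagged_partition x b s (xi \o succn)].
Proof.
move=> [ps ts]; split.
- by case: ps => /= /andP[].
- exact: (ts 0%N).
- split; first exact: itv_partition_cons ps.
  by move=> i si; exact: (ts i.+1).
Qed.

Lemma cons_tagged_partition a b x s xi : a < x -> a <= xi 0%N <= x ->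
  tagged_partition x b s (xi \o succn) -> tagged_partition a b (x :: s) xi.
Proof.
move=> ax axi [[ps ls] ts]; split.
  by split => /=; [rewrite ax|].
by case=> [_|i si] //; exact: ts.
Qed.

(** Intervals of length [d / 2] are cut off from the left until at most [d / 2]
remains; the induction is on an upper bound of their number. *)
Lemma fine_partition_exists a b d : a <= b -> 0 < d ->
  exists s xi, tagged_partition a b s xi /\ mesh_lt a b s d.
Proof.
move=> + d0; have d20 : 0 < d / 2 by rewrite divr_gt0.
suff h n : forall a, a <= b -> b - a <= n%:R * (d / 2) ->
    exists s xi, tagged_partition a b s xi /\ mesh_lt a b s d.
  move=> ab; apply: (h (Num.bound ((b - a) / (d / 2)))) => //.
  rewrite -ler_pdivrMr// ltW// archi_boundP// divr_ge0 ?subr_ge0//.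
  exact: ltW.
have hnil c : c = b -> exists s xi, tagged_partition c b s xi /\ mesh_lt c b s d.
  by move=> ->; exists [::], (fun=> b); split; [split; [split => /=|case]|case].
elim: n => [|n ih] {}a ab abn.
  by apply: hnil; apply/eqP; rewrite eq_le ab; move: abn; rewrite mul0r; lra.
move: ab; rewrite le_eqVlt => /predU1P[|ab]; first exact: hnil.
have [adb|adb] := leP b (a + d / 2).
  exists [:: b], (fun=> b); split; last by case=> //= _; lra.
  apply: cons_tagged_partition => //; first by rewrite lexx ltW.
have [||s [xi [ps ms]]] := ih (a + d / 2).
- exact: ltW.
- by move: abn; rewrite -natr1; lra.
exists (a + d / 2 :: s), (fun i => if i is j.+1 then xi j else a).
split; first by apply: cons_tagged_partition => //=; lra.
by case=> [_|i si] /=; [lra|exact: ms].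
Qed.

(** The filter of vanishing mesh: the Riemann integral is the limit of the Riemann
sums along it. *)
Definition riemann_filter a b : set_system (seq R * (nat -> R)) :=
  filter_from [set d | 0 < d]
    (fun d => [set p | tagged_partition a b p.1 p.2 /\ mesh_lt a b p.1 d]).

Lemma riemann_filter_proper a b : a <= b -> ProperFilter (riemann_filter a b).
Proof.
move=> ab; apply: filter_from_proper; last first.
  move=> d /= d0; have [s [xi h]] := fine_partition_exists ab d0.
  by exists (s, xi).
apply: filter_from_filter => [|d d' /= d0 d'0]; first by exists 1; exact: ltr01.
exists (Num.min d d'); first by rewrite /= lt_min d0.
by move=> p [tp mp]; split; split=> // i si; have := mp _ si; rewrite lt_min => /andP[].
Qed.

Section Sums.
Context {X : normedModType K}.
Implicit Types (y : R -> X).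

Lemma riemann_sum_nil y a b xi : riemann_sum ofR y a b [::] xi = 0.
Proof. by rewrite /riemann_sum big_ord0. Qed.

Lemma riemann_sum_cons y a b x s xi : riemann_sum ofR y a b (x :: s) xi =
  ofR (x - a) *: y (xi 0%N) + riemann_sum ofR y x b s (xi \o succn).
Proof. by rewrite /riemann_sum big_ord_recl. Qed.

Lemma riemann_sum_split y a c b x s xi : riemann_sum ofR y a b (x :: s) xi =
  ofR (c - a) *: y (xi 0%N) + riemann_sum ofR y c b (x :: s) xi.
Proof.
rewrite !riemann_sum_cons addrA -scalerDl -(ofRD roc).
by congr (ofR _ *: _ + _); lra.
Qed.

(** The tag [xi i] need not lie in the [i]-th interval. This makes the condition
stable under cutting an interval in two and keeping its tag for both parts. *)
Definition oscillation_le y (e : K) a b s xi := forall i u, (i < size s)%N ->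
  nth b (a :: s) i <= u <= nth b s i -> `|y (xi i) - y u| <= e.

(** Two partitions are compared from the left. If their first intervals have the
same right end, both are removed; otherwise the longer one is cut at the end of
the shorter one. Over the common first interval the two tagged values both
differ by at most [e] from the value of [y] at its left end [a]. *)
Lemma riemann_sum_close y e b s s' a xi xi' :
  itv_partition a b s -> oscillation_le y e a b s xi ->
  itv_partition a b s' -> oscillation_le y e a b s' xi' ->
  `|riemann_sum ofR y a b s xi - riemann_sum ofR y a b s' xi'| <=
    ofR (b - a) * (e + e).
Proof.
have [n] := ubnP (size s + size s').
elim: n s s' a xi xi' => // n ih s s' a xi xi' + ps os ps' os'.
case: s ps os => [|x s] ps os.
  move: (itv_partition_nil ps) ps' => -> /itv_partitionxx -> _.
  by rewrite !riemann_sum_nil !subrr normr0 (ofR0 roc) mul0r.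
case: s' ps' os' => [|x' s'] ps' os'.
  by move: (itv_partition_nil ps') ps => -> /itv_partitionxx.
wlog xx' : x x' s s' xi xi' ps os ps' os' / x <= x' => [hw|].
  have [/hw|/ltW x'x] := leP x x'; first exact.
  by rewrite distrC [(size _ + _)%N]addnC; exact: hw.
rewrite /= addSn ltnS => sn.
have ax : a < x by case: ps => /= /andP[].
have ax' : a < x' by exact: lt_le_trans xx'.
have xb := itv_partition_le (itv_partition_cons ps).
have hxi : `|y (xi 0%N) - y (xi' 0%N)| <= e + e.
  rewrite -(subrKA (y a)); apply: le_trans (ler_normD _ _) _; apply: lerD.
    by apply: (os 0%N) => //=; rewrite lexx ltW.
  by rewrite distrC; apply: (os' 0%N) => //=; rewrite lexx ltW.
have step r r' : `|r - r'| <= ofR (b - x) * (e + e) ->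
    `|ofR (x - a) *: y (xi 0%N) + r - (ofR (x - a) *: y (xi' 0%N) + r')| <=
      ofR (b - a) * (e + e).
  move=> rr'; rewrite opprD addrACA -scalerBr.
  apply: le_trans (ler_normD _ _) _.
  have -> : b - a = (x - a) + (b - x) by lra.
  rewrite [leRHS](_ : _ = ofR (x - a) * (e + e) + ofR (b - x) * (e + e)); last first.
    by rewrite (ofRD roc (x - a)) mulrDl.
  rewrite lerD// normrZ ger0_norm ?(ofR_ge0 roc) ?subr_ge0 ?(ltW ax)//.
  by rewrite ler_wpM2l// (ofR_ge0 roc) subr_ge0 ltW.
move: xx'; rewrite le_eqVlt => /predU1P[xx'|xx'].
  subst x'; rewrite !riemann_sum_cons; apply: step; apply: ih.
  - by move: sn; rewrite addnS => /ltnW.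
  - exact: itv_partition_cons ps.
  - by move=> i u si; exact: (os i.+1).
  - exact: itv_partition_cons ps'.
  - by move=> i u si; exact: (os' i.+1).
rewrite riemann_sum_cons (riemann_sum_split _ a x); apply: step; apply: ih => //.
- exact: itv_partition_cons ps.
- by move=> i u si; exact: (os i.+1).
- by case: ps' => /= /andP[_ ps'] ls'; split=> //=; rewrite xx'.
- move=> [|i] u si /= xu; last exact: (os' i.+1).
  by apply: (os' 0%N) => //=; move: xu => /andP[xu ->]; rewrite andbT; lra.
Qed.

(** Compactness of the segment makes the radius of continuity uniform. *)
Lemma uniform_continuity_segment y a b (e : K) :
  {within `[a, b], continuous y} -> 0 < e ->
  exists2 d, 0 < d & forall u v, u \in `[a, b] -> v \in `[a, b] ->
    `|u - v| < d -> `|y u - y v| <= e.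
Proof.
move=> /subspace_continuousP cy e0.
have := @segment_compact R a b; move=> /compact_near_coveringP/near_covering_withinP.
move=> /(_ R 0^'+ (fun d u => forall v, v \in `[a, b] -> `|u - v| < d -> `|y u - y v| <= e) _).
case.
- move=> x abx; have e20 : 0 < e / 2 by rewrite divr_gt0.
  have /cvgrPdist_lt /(_ _ e20) := cy x abx.
  move=> /nbhs_ballP[d /= d0 xd].
  have d20 : 0 < d / 2 by rewrite divr_gt0.
  exists (ball x (d / 2), [set r | r < d / 2]).
    by split=> /=; [exact: nbhsx_ballx|exact: nbhs_right_lt].
  move=> [u r] [/= xu rd] abu v abv uvr.
  rewrite -(subrKA (y x)) [leRHS]splitr; apply: le_trans (ler_normD _ _) _.
  move: xu; rewrite -ball_normE /ball_/= => xu.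
  apply: lerD; apply: ltW.
    rewrite distrC; apply: xd => //; rewrite -ball_normE /ball_/=.
    by apply: lt_le_trans xu _; lra.
  apply: xd => //; rewrite -ball_normE /ball_/= -(subrKA u).
  by apply: le_lt_trans (ler_normD _ _) _; lra.
- move=> d /= d0 hd; have d20 : 0 < d / 2 by rewrite divr_gt0.
  exists (d / 2) => // u v abu abv uv; apply: (hd (d / 2)) => //=.
  by rewrite sub0r normrN gtr0_norm//; lra.
Qed.

End Sums.

Section Integrals.
Context {X : completeNormedModType K}.
Implicit Types (y : R -> X).

Lemma oscillation_mesh y (e : K) a b s xi d :
  (forall u v, u \in `[a, b] -> v \in `[a, b] -> `|u - v| < d -> `|y u - y v| <= e) ->
  tagged_partition a b s xi -> mesh_lt a b s d -> oscillation_le y e a b s xi.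
Proof.
move=> yd [ps ts] ms i u si iu.
have := ts _ si; have := ms _ si.
have := itv_partition_nth_ge (ltnW si : (i < (size s).+1)%N) ps.
have := itv_partition_nth_le (si : (i.+1 < (size s).+1)%N) ps.
move: iu => /= /andP[iu ui] h1 h2 h3 /andP[h4 h5].
apply: yd; rewrite ?in_itv /= ?ltr_norml; lra.
Qed.

(** The Riemann sums form a Cauchy filter, by [riemann_sum_close] and uniform
continuity. *)
Lemma riemann_sum_cvg y a b : a <= b -> {within `[a, b], continuous y} ->
  cvg (riemann_sum ofR y a b p.1 p.2 @[p --> riemann_filter a b]).
Proof.
move=> ab cy; have FP := riemann_filter_proper ab.
apply/cauchy_cvgP; apply: cauchy_exP => e e0.
(* The summand 1 keeps the divisor positive when a = b. *)
have l0 : 0 < ofR (b - a + 1) by rewrite (ofR_gt0 roc); lra.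
have e'0 : 0 < e / 2 / ofR (b - a + 1) by rewrite !divr_gt0.
have [d d0 yd] := uniform_continuity_segment cy e'0.
have [s [xi [ps ms]]] := fine_partition_exists ab d0.
exists (riemann_sum ofR y a b s xi); exists d => // -[s' xi'] [/= ps' ms'].
rewrite -ball_normE /ball_/=.
have := riemann_sum_close ps.1 (oscillation_mesh yd ps ms) ps'.1
  (oscillation_mesh yd ps' ms').
move=> /le_lt_trans; apply.
rewrite -mulrDl -splitr mulrCA gtr_pMr// ltr_pdivrMr// mul1r (ofR_lt roc); lra.
Qed.

Lemma is_riemann_integralP y a b I : a <= b ->
  is_riemann_integral ofR y a b I <->
  riemann_sum ofR y a b p.1 p.2 @[p --> riemann_filter a b] --> I.
Proof.
move=> ab; have FP := riemann_filter_proper ab.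
split=> [h|/cvgrPdist_lt h e e0].
  apply/cvgrPdist_lt => e e0; have [r er] := ge0_ofR roc (ltW e0).
  have r0 : 0 < r by rewrite -(ofR_gt0 roc) -er.
  have [d d0 hd] := h r r0; exists d => // -[s xi] [/= ps ms].
  by rewrite er distrC; exact: hd.
have [|d d0 hd] := h (ofR e); first by rewrite (ofR_gt0 roc).
by exists d => // s xi ps ms; rewrite distrC; exact: (hd (s, xi)).
Qed.

Lemma riemann_integral_cvg y a b : a <= b -> {within `[a, b], continuous y} ->
  riemann_sum ofR y a b p.1 p.2 @[p --> riemann_filter a b] -->
  riemann_integral ofR y a b.
Proof.
move=> ab cy; apply/is_riemann_integralP => //.
have /cvg_ex[I /is_riemann_integralP - /(_ ab) hI] := riemann_sum_cvg ab cy.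
exact: (@xgetI _ 0 _ I).
Qed.

Lemma norm_riemann_sum_le y (C : R) a b s xi : tagged_partition a b s xi ->
  (forall u, u \in `[a, b] -> `|y u| <= ofR C) ->
  `|riemann_sum ofR y a b s xi| <= ofR (C * (b - a)).
Proof.
elim: s a xi => [a xi [/itv_partition_nil -> _] _|x s ih a xi].
  by rewrite riemann_sum_nil subrr mulr0 normr0 (ofR0 roc).
move=> /tagged_partition_cons[ax /andP[axi xix] ps] yC.
have xb := itv_partition_le ps.1.
rewrite riemann_sum_cons; apply: le_trans (ler_normD _ _) _.
have -> : C * (b - a) = (x - a) * C + C * (b - x) by lra.
rewrite (ofRD roc ((x - a) * C)) lerD//.
  rewrite normrZ (normr_ofR roc) gtr0_norm ?subr_gt0// (ofRM roc) ler_wpM2l//.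
    by rewrite (ofR_ge0 roc); lra.
  by apply: yC; rewrite in_itv/=; lra.
apply: ih => // u; rewrite in_itv/= => xu; apply: yC; rewrite in_itv/=; lra.
Qed.

Lemma norm_riemann_integral_le y (C : R) a b : a <= b ->
  {within `[a, b], continuous y} ->
  (forall u, u \in `[a, b] -> `|y u| <= ofR C) ->
  `|riemann_integral ofR y a b| <= ofR (C * (b - a)).
Proof.
move=> ab cy yC; have FP := riemann_filter_proper ab.
have cI := riemann_integral_cvg ab cy.
apply: norm_limit_le cI _ => //; exists 1 => [|[s xi] [/= ps _]]; first exact: ltr01.
exact: norm_riemann_sum_le.
Qed.

Lemma dual_riemann_sum (f : X -> K^o) y (c : K) a b s xi :
  linear f -> tagged_partition a b s xi -> (forall u, u \in `[a, b] -> f (y u) = c) ->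
  f (riemann_sum ofR y a b s xi) = ofR (b - a) * c.
Proof.
move=> lf; have [g fg] := linear_bundle lf; rewrite {}fg.
elim: s a xi => [a xi [/itv_partition_nil -> _] _|x s ih a xi].
  by rewrite riemann_sum_nil subrr linear0 (ofR0 roc) mul0r.
move=> /tagged_partition_cons[ax /andP[axi xix] ps] yc.
have xb := itv_partition_le ps.1.
rewrite riemann_sum_cons linearD linearZ /= yc ?in_itv/=; last by lra.
rewrite ih//; last first.
  by move=> u; rewrite in_itv/= => xu; apply: yc; rewrite in_itv/=; lra.
rewrite [_ *: _]/(_ * _) -mulrDl -(ofRD roc); congr (ofR _ * _); lra.
Qed.

Lemma dual_riemann_integral (f : X -> K^o) y (c : K) a b : dual_space f ->
  a <= b -> {within `[a, b], continuous y} ->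
  (forall u, u \in `[a, b] -> f (y u) = c) ->
  f (riemann_integral ofR y a b) = ofR (b - a) * c.
Proof.
move=> df ab cy yc; have FP := riemann_filter_proper ab.
have cI := riemann_integral_cvg ab cy.
have fI := @continuous_cvg _ _ _ _ _ _ f _ (df.2 _) cI.
have hK : hausdorff_space K^o by exact: norm_hausdorff.
apply: (cvg_unique hK (fI _)).
apply: cvg_near_cst; exists 1 => [/=|[s xi] [/= ps _]]; first exact: ltr01.
exact: dual_riemann_sum df.1 ps yc.
Qed.

End Integrals.
End RiemannSums.

(** * Weak limits along ultrafilters *)

(** If [h] did not converge to [l] along [F], then for some neighbourhood [B] of [l]
an ultrafilter finer than [F] would contain the complement of the preimage of
[B]. *)
Lemma cvg_ultraP {T : Type} {V : nbhsType} (F : set_system T) (FF : ProperFilter F)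
    (h : T -> V) (l : V) :
  (forall U, UltraFilter U -> F `<=` U -> h @ U --> l) -> h @ F --> l.
Proof.
move=> hU B lB; apply: contrapT; rewrite -[nbhs _ B]/(F (h @^-1` B)) => nFB.
have GP : ProperFilter (within (~` (h @^-1` B)) F).
  split; last exact: within_filter.
  move=> F0; apply: nFB; apply: (@filterS _ F _ _ _ _ (F0 : F _)) => t ht.
  by apply: contrapT => nB; exact: ht.
have [U [UU GU]] := ultraFilterLemma GP.
have FU : F `<=` U by move=> S FS; apply: GU; apply: filterS FS => t.
have UB : U (h @^-1` B) := hU U UU FU _ lB.
have UNB : U (~` (h @^-1` B)) by apply: GU; exact: withinT.
by have [t [Bt NBt]] := filter_ex (filterI UB UNB); exact: NBt.
Qed.

Section Mean.
Context {R : realType} {K : numFieldType} {ofR : R -> K}.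
Hypothesis roc : real_or_complex ofR.

Lemma dual_norm_bound (X : normedModType K) (f : X -> K^o) x :
  dual_space f -> `|f x| <= ofR (dual_norm ofR f) * `|x|.
Proof.
move=> df; have [C C0 fC] := dual_bounded roc df.
have [->|x0] := eqVneq x 0.
  by have := fC 0; rewrite normr0 !mulr0.
have nx : 0 < rnorm ofR x by rewrite -(ofR_gt0 roc) (rnormE roc) normr_gt0.
rewrite -!(rnormE roc) -(ofRM roc) (ofR_le roc) -ler_pdivrMr//.
apply: lb_le_inf; first by exists C.
move=> c /= [_ /(_ x)]; rewrite ler_pdivrMr//.
by rewrite -!(rnormE roc) -(ofRM roc) (ofR_le roc).
Qed.

(** The bounded scalars [f (m t)] converge along an ultrafilter, and their limit is
a bounded linear function of [f]. Reflexivity represents it by a point. *)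
Lemma reflexive_ultra_weak_cvg (X : normedModType K) (T : Type) (U : set_system T)
    (UU : UltraFilter U) (m : T -> X) (C : R) :
  reflexive_space ofR X -> (\forall t \near U, `|m t| <= ofR C) ->
  exists x, weak_cvg m U x.
Proof.
move=> rX mC; have UP : ProperFilter U by exact: ultra_proper.
have fmC (f : X -> K^o) : dual_space f ->
    \forall t \near U, `|f (m t)| <= ofR (C * dual_norm ofR f).
  move=> df; near=> t; apply: le_trans (dual_norm_bound _ df) _.
  rewrite (ofRM roc) mulrC ler_wpM2r//; last by near: t.
  rewrite (ofR_ge0 roc); have [c c0 fc] := dual_bounded roc df.
  by apply: lb_le_inf; [exists c|move=> ? []].
have cf (f : X -> K^o) : dual_space f -> cvg (f (m t) @[t --> U]).
  by move=> /fmC; exact: ultra_cvg_bounded.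
have hK : hausdorff_space K^o by exact: norm_hausdorff.
have [|x hx] := rX (fun f => lim (f (m t) @[t --> U])).
  split=> [a f g df dg|].
    apply: cvg_lim => //; apply: cvgD; last exact: cf.
    by apply: cvgZl_tmp; exact: cf.
  by exists C => f df; exact: (norm_limit_le roc UP (cf f df) (fmC f df)).
by exists x => f df; rewrite -hx//; exact: cf.
Unshelve. all: by end_near. Qed.

Lemma graph_subspace (X : normedModType K) (A : linear_operator X) :
  subspace (graph A).
Proof.
have A0 : A 0 = 0.
  have := oper_linear (-1) (dom0 A) (dom0 A).
  by rewrite scaler0 addr0 scaleN1r addNr.
split=> [|a [u u'] [v v'] [/= du ->] [/= dv ->]]; first by split; [exact: dom0|].
by split => /=; [exact: dom_linear|rewrite oper_linear].
Qed.

Lemma ran_subspace (X : normedModType K) (A : linear_operator X) :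
  subspace (ran A).
Proof.
have [g0 gl] := graph_subspace A; split; first by exists 0; [exact: g0.1|rewrite -g0.2].
move=> a _ _ [u du <-] [v dv <-]; exists (a *: u + v); first exact: dom_linear.
exact: oper_linear.
Qed.

(** The pairs [(m t, A (m t))] converge weakly to [(x, 0)]. A functional [Phi] on
[X * X] that vanishes on the graph satisfies [Phi (m t, 0) = - Phi (0, A (m t))],
where the left side tends to [Phi (x, 0)] and the right side to [0]. *)
Lemma weak_limit_ker (X : normedModType K) (A : linear_operator X) (T : Type)
    (F : set_system T) (FF : ProperFilter F) (m : T -> X) x :
  closed_operator A -> weak_cvg m F x -> (\forall t \near F, dom A (m t)) ->
  A (m t) @[t --> F] --> 0 -> ker A x.
Proof.
move=> cA mx dm Am.
suff : closure (graph A) (x, 0).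
  by rewrite -(closure_id _).1// => -[/= dx Ax]; split.
apply: (closure_separation roc (graph_subspace A)) => Phi dPhi Phi0.
have [C C0 PhiC] := dual_bounded roc dPhi.
have [P PhiE] := linear_bundle dPhi.1; subst Phi.
have df : dual_space ((fun u => P (u, 0)) : X -> K^o).
  apply: (bounded_dual roc _ C0) => [a u v|u].
    have -> : (a *: u + v, 0) = a *: (u, 0) + (v, 0) :> X * X.
      by congr (_, _); rewrite /= scaler0 addr0.
    exact: linearP.
  by apply: le_trans (PhiC _) _; rewrite prod_normE /= normr0 max_l.
have dg : dual_space ((fun v => P (0, v)) : X -> K^o).
  apply: (bounded_dual roc _ C0) => [a u v|v].
    have -> : (0, a *: u + v) = a *: (0, u) + (0, v) :> X * X.
      by congr (_, _); rewrite /= scaler0 addr0.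
    exact: linearP.
  by apply: le_trans (PhiC _) _; rewrite prod_normE /= normr0 max_r.
have fx := mx _ df.
have P0 : P (0, 0) = 0 := linear0 P.
have := cvgN (@continuous_cvg _ _ _ _ _ _ _ _ (dg.2 _) Am).
rewrite /= P0 oppr0 => /(_ _ _) gA.
have hK : hausdorff_space K^o by exact: norm_hausdorff.
apply: (cvg_unique hK fx); apply: cvg_trans gA; apply: near_eq_cvg.
apply: filterS dm => t dmt; have PA : P (m t, A (m t)) = 0 by apply: Phi0.
apply/esym/eqP; rewrite -subr_eq0 opprK -raddfD /= -PA; apply/eqP.
by congr (P (_, _)); rewrite ?addr0 ?add0r.
Qed.

(** * Means of bounded weak solutions *)

Lemma mean_bounded (X : completeNormedModType K) (y : R -> X) :
  {within `[0, +oo[, continuous y} -> bounded_on_halfline y ->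
  exists2 C, 0 <= C & (forall t, 0 <= t -> `|y t| <= ofR C) /\
    (forall t, 0 < t -> `|mean ofR y t| <= ofR C).
Proof.
move=> cy /pinfty_ex_gt0[k k0 yk].
have [C kC] := ge0_ofR roc (ltW k0).
have yC t : 0 <= t -> `|y t| <= ofR C.
  by move=> t0; rewrite -kC; apply: yk; rewrite /= in_itv/= t0.
exists C; first by rewrite -(ofR_ge0 roc) -kC ltW.
split=> // t t0; rewrite /mean normrZ (normr_ofR roc).
rewrite gtr0_norm ?invr_gt0// (ofRV roc) ler_pdivrMl ?(ofR_gt0 roc)//.
rewrite -(ofRM roc) mulrC -{2}(subr0 t).
apply: (norm_riemann_integral_le roc) (ltW t0) _ _ => [|u].
  apply: continuous_subspaceW cy => u /=; rewrite !in_itv/= andbT.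
  by move=> /andP[].
by rewrite in_itv/= => /andP[u0 _]; exact: yC.
Qed.

Section WeakSolution.
Context {X : completeNormedModType K} {A : linear_operator X} {y : R -> X}.
Hypothesis ysol : weak_solution ofR A y.

Lemma oper_mean t : 0 < t ->
  dom A (mean ofR y t) /\ A (mean ofR y t) = ofR t^-1 *: (y t - y 0).
Proof.
move=> t0; have [dI yt] := ysol.2 t (ltW t0).
set I := riemann_integral _ _ _ _ in dI yt.
have [g0 gl] := graph_subspace A.
have [/= dm Am] := gl (ofR t^-1) (I, A I) _ (conj dI erefl) g0.
rewrite !addr0 in dm Am; split => //.
by rewrite [y t]yt addrAC subrr add0r /mean -/I Am.
Qed.

(** Since [y u - y 0] is in the range of [A], [f (y u)] is the same for all [u >= 0]. *)
Lemma dual_mean (f : X -> K^o) t : dual_space f ->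
  (forall v, ran A v -> f v = 0) -> 0 < t -> f (mean ofR y t) = f (y 0).
Proof.
move=> df fA t0; have [g fg] := linear_bundle df.1; subst f.
have gy u : u \in `[0, t] -> g (y u) = g (y 0).
  rewrite in_itv/= => /andP[u0 _]; have [dI ->] := ysol.2 u u0.
  by rewrite linearD /= [g (A _)]fA ?addr0//; exists (riemann_integral ofR y 0 u).
rewrite /mean linearZ /= (dual_riemann_integral roc df (ltW t0) _ gy).
  rewrite [LHS]mulrA -(ofRM roc) subr0 mulVf ?gt_eqF//.
  by rewrite (ofR1 roc) mul1r.
apply: continuous_subspaceW ysol.1 => u /=; rewrite !in_itv/= andbT.
by move=> /andP[].
Qed.

Hypothesis ybd : bounded_on_halfline y.

Lemma oper_mean_cvg0 : A (mean ofR y t) @[t --> +oo] --> 0.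
Proof.
have [C C0 [yC _]] := mean_bounded ysol.1 ybd.
apply/cvgr0Pnorm_lt => e e0; have [r er] := ge0_ofR roc (ltW e0).
have r0 : 0 < r by rewrite -(ofR_gt0 roc) -er.
near=> t; have t0 : 0 < t by near: t; exact: nbhs_pinfty_gt.
rewrite (oper_mean t0).2 normrZ (normr_ofR roc) gtr0_norm ?invr_gt0//.
apply: le_lt_trans (_ : ofR t^-1 * (ofR C + ofR C) < _).
  rewrite ler_wpM2l ?(ofR_ge0 roc) ?invr_ge0 ?(ltW t0)//.
  by apply: le_trans (ler_normB _ _) _; rewrite lerD ?yC// ltW.
rewrite er -(ofRD roc) -(ofRM roc) (ofR_lt roc) ltr_pdivrMl//.
rewrite -ltr_pdivrMr//; near: t; apply: nbhs_pinfty_gt.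
by rewrite num_real.
Unshelve. all: by end_near. Qed.

Lemma mean_ultra_limit (U : set_system R) :
  reflexive_space ofR X -> closed_operator A -> UltraFilter U -> +oo `<=` U ->
  exists x, weak_cvg (mean ofR y) U x /\ ker A x.
Proof.
move=> rX cA UU oU; have UP : ProperFilter U by exact: ultra_proper.
have [C C0 [_ mC]] := mean_bounded ysol.1 ybd.
have U0 : \forall t \near U, 0 < t by apply: oU; exact: nbhs_pinfty_gt.
have [|x mx] := @reflexive_ultra_weak_cvg X _ U UU (mean ofR y) C rX.
  by apply: filterS U0.
exists x; split=> //; apply: weak_limit_ker cA mx _ _.
  by apply: filterS U0 => t /oper_mean[].
by move=> B /oper_mean_cvg0; exact: oU.
Qed.

End WeakSolution.
End Mean.

Theorem theorem6p1 (R : realType) (K : numFieldType) (ofR : R -> K)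
    (X : completeNormedModType K) (A : linear_operator X) :
  real_or_complex ofR -> reflexive_space ofR X -> closed_operator A ->
  (ker A = [set 0] ->
     forall y : R -> X, weak_solution ofR A y -> bounded_on_halfline y ->
       weak_cvg (mean ofR y) +oo 0) /\
  (direct_sum (ker A) (closure (ran A)) ->
     forall y : R -> X, weak_solution ofR A y -> bounded_on_halfline y ->
       weak_cvg (mean ofR y) +oo
         (projection_along (ker A) (closure (ran A)) (y 0))).
Proof.
move=> roc rX cA; split=> [kerA|dsum] y ysol ybd f df; apply: cvg_ultraP => U UU oU;
  have [x [mx kx]] := mean_ultra_limit roc ysol ybd rX cA UU oU.
  suff <- : x = 0 by exact: mx.
  by move: kx; rewrite kerA.
set N := closure (ran A).
have UP : ProperFilter U by exact: ultra_proper.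
have hK : hausdorff_space K^o by exact: norm_hausdorff.
have fx g : dual_space g -> (forall v, ran A v -> g v = 0) -> g x = g (y 0).
  move=> dg gA; apply: (cvg_unique hK (mx _ dg)); apply: cvg_near_cst.
  apply: oU; near=> t; apply: (dual_mean roc ysol dg gA).
  by near: t; exact: nbhs_pinfty_gt.
have Nyx : N (y 0 - x).
  apply: (closure_separation roc (ran_subspace A)) => g dg gA.
  have [h gh] := linear_bundle dg.1; subst g.
  by rewrite linearB /= fx// subrr.
suff -> : projection_along (ker A) N (y 0) = x by exact: mx.
have [/= ku Nyu] : [set u | ker A u /\ N (y 0 - u)] (projection_along (ker A) N (y 0)).
  exact: (@xgetI _ 0 _ x).
(* Both u and x are components of y 0 in ker A, so u - x is in ker A and in N. *)
set u := projection_along _ _ _ in ku Nyu *.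
have kux : ker A (u - x).
  have [_ gl] := graph_subspace A.
  have [/= d e] := gl (-1) (x, 0) (u, 0) (conj kx.1 (esym kx.2)) (conj ku.1 (esym ku.2)).
  by rewrite scaleN1r addrC in d e; split=> //; rewrite -e scaler0 addr0.
have Nux : N (u - x).
  apply: (closure_separation roc (ran_subspace A)) => g dg gA.
  have [h gh] := linear_bundle dg.1; subst g.
  rewrite linearB /= fx//; apply/eqP; rewrite subr_eq0 eq_sym -subr_eq0 -linearB.
  by apply/eqP; exact: (dual_closure_eq0 dg gA).
apply/eqP; rewrite -subr_eq0; apply/eqP.
have : (ker A `&` N) (u - x) by split.
by rewrite dsum.1.
Unshelve. all: by end_near. Qed.
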